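(* Let $A\subset\mathcal X$ be nonempty and $x\notin A$, and suppose Assumption B holds: the limit $\Theta_*(x,A)=\lim_{\beta\to\infty}\frac1\beta\log\mathbb E\,\tau^x_A$ satisfies $\Theta_*(x,A)>\widetilde\Gamma(\mathcal X\setminus(A\cup\{x\}))$. Then $\tau^x_A/\mathbb E\,\tau^x_A$ converges in distribution to an exponential random variable with mean $1$ as $\beta\to\infty$. More precisely, there exist functions $k_1(\beta),k_2(\beta)$ with $\lim_{\beta\to\infty}k_1(\beta)=\lim_{\beta\to\infty}k_2(\beta)=0$ such that for every $s>0$ $$\Big|\mathbb P\Big(\frac{\tau^x_A}{\mathbb E\,\tau^x_A}>s\Big)-e^{-s}\Big|\le k_1(\beta)e^{-(1-k_2(\beta))s}.$$
   Context: Setting: $\mathcal X$ finite, $H:\mathcal X\to\mathbb R$ non-constant, $q$ a stochastic, symmetric, irreducible matrix on $\mathcal X$. A path is a finite sequence $(\omega_1,\dots,\omega_n)$ with $q(\omega_i,\omega_{i+1})>0$. For $\beta>0$ the Metropolis chain has $P_\beta(x,y)=q(x,y)e^{-\beta[H(y)-H(x)]^+}$ ($x\ne y$), $P_\beta(x,x)=1-\sum_{z\ne x}P_\beta(x,z)$; $\tau^x_A=\inf\{t>0:X_t\in A\}$ for the chain started at $x$. $\Phi_\omega=\max_iH(\omega_i)$, $\Phi(x,y)=\min$ of $\Phi_\omega$ over paths from $x$ to $y$, $\Phi(B,D)=\min_{x\in B,y\in D}\Phi(x,y)$. Connected set: at least two elements, any two joined by a path inside it. $\partial B=\{y\notin B:\exists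 x\in B,q(x,y)>0\}$; $\mathcal F(B)$ = minimizers of $H$ on $B$. A cycle is a nonempty $C$ that is a singleton or connected with $\max_CH<H(\mathcal F(\partial C))$; depth $\Gamma(C)=\Phi(C,\mathcal X\setminus C)-H(\mathcal F(C))$. For nonempty $B\subsetneq\mathcal X$, $\widetilde\Gamma(B)=\max\{\Gamma(C):C$ a maximal (for inclusion) cycle contained in $B\}$. Convention: $A$ contains every $y$ such that every path from $x$ to $y$ meets $A$. *)

(* Defs.v *)
From HB Require Import structures.
From mathcomp Require Import all_boot all_order all_algebra.
From mathcomp Require Import all_classical all_reals all_analysis.
Set Implicit Arguments. Unset Strict Implicit. Unset Printing Implicit Defensive.
Import Order.TTheory GRing.Theory Num.Theory.
Import numFieldNormedType.Exports.
Local Open Scope ring_scope.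
Local Open Scope classical_set_scope.

Section Defs.
Variables (R : realType) (X : finType) (H : X -> R) (q : X -> X -> R).

Definition qrel : rel X := fun a b => 0 < q a b.

Definition path_from_to (x y : X) (s : seq X) : Prop :=
  path qrel x s /\ last x s = y.

Definition Phi_omega (x : X) (s : seq X) : R :=
  foldr (fun z m => Num.max (H z) m) (H x) s.

Definition Phi (x y : X) : R :=
  inf [set c | exists s, path_from_to x y s /\ c = Phi_omega x s].

Definition PhiS (B D : {set X}) : R :=
  inf [set c | exists x y, [/\ x \in B, y \in D & c = Phi x y]].

Definition boundary (B : {set X}) : {set X} :=
  [set y | (y \notin B) && [exists z in B, 0 < q z y]].

Definition connected_set (C : {set X}) : Prop :=
  (1 < #|C|)%N /\
  forall a b, a \in C -> b \in C ->
    exists s, path_from_to a b s /\ all (fun z => z \in C) s.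

(* cycle: singleton, or connected with max_C H < H(F(boundary C))
   (i.e. H z < H w for all z in C, w in the boundary; when the boundary
   is empty, H(F(empty)) = +oo and the condition holds) *)
Definition is_cycle (C : {set X}) : Prop :=
  #|C| = 1%N \/
  (connected_set C /\
   forall z w, z \in C -> w \in boundary C -> H z < H w).

Definition Hmin (C : {set X}) : R := inf [set c | exists2 z, z \in C & c = H z].

Definition depth (C : {set X}) : R := PhiS C (~: C) - Hmin C.

Definition max_cycle_in (B C : {set X}) : Prop :=
  [/\ is_cycle C, C \subset B &
      forall C' : {set X}, is_cycle C' -> C \subset C' -> C' \subset B -> C' = C].

(* Gamma~(B) = max of depths of maximal cycles in B.  All depths are >= 0 and
   a nonempty B has a maximal cycle, so the default 0 only matters for B = set0. *)
Definition Gtilde (B : {set X}) : R :=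
  \big[Num.max/0]_(C : {set X} | `[< max_cycle_in B C >]) depth C.

Definition Pmet (b : R) (x y : X) : R :=
  if x == y then
    1 - \sum_(z | z != x) q x z * expR (- (b * Num.max 0 (H z - H x)))
  else q x y * expR (- (b * Num.max 0 (H y - H x))).

(* surv b A t y = P(tau^y_A > t) = P(X_1,...,X_t all outside A | X_0 = y) *)
Fixpoint surv (b : R) (A : {set X}) (t : nat) (y : X) : R :=
  match t with
  | 0 => 1
  | t'.+1 => \sum_(z | z \notin A) Pmet b y z * surv b A t' z
  end.

(* P(tau^y_A = k) for k >= 1 (and 0 for k = 0) *)
Definition hitprob (b : R) (A : {set X}) (k : nat) (y : X) : R :=
  surv b A k.-1 y - surv b A k y.

Definition Etau (b : R) (A : {set X}) (y : X) : R :=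
  limn (fun n => \sum_(0 <= k < n) ((k%:R : R) * hitprob b A k y)).

(* P(tau^y_A > u) for a real u >= 0 : tau is integer valued *)
Definition tail (b : R) (A : {set X}) (y : X) (u : R) : R :=
  surv b A (Num.truncn u) y.

End Defs.

(* Main.v *)
Require Import Defs.
From HB Require Import structures.
From mathcomp Require Import all_boot all_order all_algebra.
From mathcomp Require Import all_classical all_reals all_analysis.
From mathcomp Require Import ring lra.
Set Implicit Arguments. Unset Strict Implicit. Unset Printing Implicit Defensive.
Import Order.TTheory GRing.Theory Num.Theory.
Import numFieldNormedType.Exports.
Local Open Scope ring_scope.
Local Open Scope classical_set_scope.

(** Let D be the complement of A :|: [set x]. A point z of D can leave D without climbing more
    than Gtilde D above H z: if the barrier is higher, then the component of z in the
    sublevel set below it is a maximal cycle of D whose depth exceeds Gtilde D. Bounding a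
    function by its increments along such exit paths gives a Poincare inequality with
    constant of order exp (b * Gtilde D); by reversibility the killed chain then loses
    mass at the inverse rate, so from every point A :|: [set x] is hit within
    r ~ exp (b * (Gtilde D + eps)) steps up to a small probability, and r is negligible
    with respect to E tau since Theta > Gtilde D.

    Let f t = P(tau^x_A > t) and F t = max_y P(tau^y_A > t). Regeneration at x gives
    f (t + u) >= (f (t + r) - eta f t) f u and F (r + u) <= eta F u + f u, while F is
    submultiplicative. With lam = inf_t (F t)^(1/t) this forces f t = (1 + O(eta)) lam^t
    for all t, hence E tau = (1 + O(eta)) / (1 - lam), and the exponential law follows. *)

(** * Decay rates of sub- and supermultiplicative sequences *)

(* A Fekete argument: lam is inf_(t > 0) (F t)^(1/t), and f (t + r) - eta * f t, being a
   supermultiplicative rate, cannot exceed lam ^+ t. *)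
Lemma decay_rate (R : realType) (f F : nat -> R) (r : nat) (eta : R) :
    (forall n, 0 <= f n) -> (forall n, f n <= F n) -> F 0%N = 1 ->
    f 0%N = 1 -> 0 <= eta -> f r <= 1 ->
    (forall t u, F (t + u)%N <= F t * F u) ->
    (forall t u, (f (t + r)%N - eta * f t) * f u <= f (t + u)%N) ->
  exists lam : R, [/\ 0 <= lam, forall u, lam ^+ u <= F u &
    forall t, f (t + r)%N - eta * f t <= lam ^+ t].
Proof.
move=> f0 fF F0 f01 eta0 fr1 subF supf.
have FX u n : F (u * n)%N <= F u ^+ n.
  elim: n => [|n IH]; first by rewrite muln0 F0 expr0.
  rewrite mulnS exprS; apply: (le_trans (subF _ _)).
  by rewrite ler_wpM2l// (le_trans (f0 u)).
have F_ge0 u : 0 <= F u by apply: le_trans (f0 u) (fF u).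
pose g t := f (t + r)%N - eta * f t.
have gX t n : 0 <= g t -> g t ^+ n <= f (t * n)%N.
  move=> gt0; elim: n => [|n IH]; first by rewrite muln0 f01 expr0.
  rewrite mulnS exprS; apply: le_trans (supf _ _).
  by rewrite ler_wpM2l.
pose S := [set c : R | exists n : nat, c = F n.+1 `^ n.+1%:R^-1].
have S0 : S !=set0 by exists (F 1%N `^ 1%:R^-1), 0%N.
have lbS : lbound S 0 by move=> c [n ->]; exact: powR_ge0.
have rootK (c : R) n : 0 <= c -> (c `^ n.+1%:R^-1) ^+ n.+1 = c.
  by move=> c0; rewrite -powR_mulrn ?powR_ge0// -powRrM mulVf ?pnatr_eq0// powRr1.
exists (inf S); split; first exact: lb_le_inf.
- case=> [|u]; first by rewrite F0 expr0.
  rewrite -[leRHS](rootK _ u)// ler_pXn2r ?nnegrE ?powR_ge0//.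
    by apply: ge_inf; [exists 0 | exists u].
  exact: lb_le_inf.
- move=> t; rewrite -/(g t); case: (leP (g t) 0) => [gle|g_gt0].
    by apply: (le_trans gle); rewrite exprn_ge0//; exact: lb_le_inf.
  case: t g_gt0 => [|t] gt0.
    by rewrite expr0 /g add0n f01; lra.
  rewrite -[leLHS](rootK _ t) ?(ltW gt0)// ler_pXn2r ?nnegrE ?powR_ge0//; last first.
    exact: lb_le_inf.
  apply: lb_le_inf => // c [u ->].
  (* Both roots are raised to the common power [t.+1 * u.+1], which reduces the claim to [g t.+1 ^+
     u.+1 <= f (t.+1 * u.+1) <= F (u.+1 * t.+1) <= F u.+1 ^+ t.+1]. *)
  have N_gt0 : (0 < t.+1 * u.+1)%N by rewrite muln_gt0.
  rewrite -(ler_pXn2r N_gt0) ?nnegrE ?powR_ge0//.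
  rewrite [leLHS]exprM rootK ?(ltW gt0)// mulnC exprM rootK//.
  apply: (le_trans (gX _ _ (ltW gt0))); apply: (le_trans (fF _)).
  by rewrite mulnC.
Qed.

Lemma sum_geometric_lt1 (R : realType) (lam : R) n : lam < 1 ->
  \sum_(0 <= k < n) lam ^+ k = (1 - lam ^+ n) / (1 - lam).
Proof.
move=> lt1; have ne0 : 1 - lam != 0 by rewrite gt_eqF// subr_gt0.
elim: n => [|n IH]; first by rewrite big_geq// expr0 subrr mul0r.
by rewrite big_nat_recr//= IH exprS; field.
Qed.

Lemma bernoulli_sub (R : realType) (c : R) n : 0 <= c <= 1 -> 1 - n%:R * c <= (1 - c) ^+ n.
Proof.
move=> /andP[c0 c1]; elim: n => [|n IH]; first by rewrite expr0 mul0r subr0.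
have h : (1 - c) ^+ n <= 1 by apply: exprn_ile1; lra.
rewrite exprSr -natr1; nra.
Qed.

(** [sum_le] and [sum_sup] say that [E] is the sum of [f]. Summing
    [f (t + r) <= lam ^+ t + eta * f t] gives [E <= r + eta * E + (1 - lam)^-1], so that
    [r <= eta * E] makes [r] short for the rate [1 - lam] as well. Upper bounds then propagate in
    steps of [r], and [lam ^+ t <= F t] yields the lower one. *)
Lemma near_geometric_survival (R : realType) (f F : nat -> R) (r : nat) (E eta : R)
    (f_ge0 : forall n, 0 <= f n) (f_le_F : forall n, f n <= F n)
    (F_le1 : forall n, F n <= 1) (F0 : F 0%N = 1) (f0 : f 0%N = 1)
    (F_sub : forall t u, F (t + u)%N <= F t * F u)
    (F_relax : forall u, F (r + u)%N <= eta * F u + f u)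
    (f_super : forall t u, (f (t + r)%N - eta * f t) * f u <= f (t + u)%N)
    (F_lt1 : exists N, F N < 1)
    (sum_le : forall n, \sum_(0 <= k < n) f k <= E)
    (sum_sup : forall M : R, (forall n, \sum_(0 <= k < n) f k <= M) -> E <= M)
    (eta_gt0 : 0 < eta) (eta_le : 12 * eta <= 1)
    (r_gt0 : (0 < r)%N) (r_le : r%:R <= eta * E) :
  exists lam : R, [/\ 0 < lam < 1, 1 - lam <= 2 * eta,
    forall t, (1 - 4 * eta) * lam ^+ t <= f t <= (1 + 4 * eta) * lam ^+ t &
    1 - 4 * eta <= E * (1 - lam) <= 1 + 4 * eta].
Proof.
have f_le1 n : f n <= 1 by apply: le_trans (f_le_F n) (F_le1 n).
have [lam [lam0 lamF flam]] := decay_rate f_ge0 f_le_F F0 f0 (ltW eta_gt0) (f_le1 r)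
  F_sub f_super.
have lam1 : lam < 1.
  have [N FN] := F_lt1; rewrite ltNge; apply/negP => lam1.
  by move: (le_lt_trans (lamF N) FN); rewrite ltNge exprn_ege1.
have r1 : 1 <= r%:R :> R by rewrite (ler_nat _ 1).
have E1 : 1 <= E by have := sum_le 1; rewrite big_nat1 f0.
have lam'0 : 0 < 1 - lam by rewrite subr_gt0.
have Eupper : E * (1 - 2 * eta) <= (1 - lam)^-1.
  have EM : E <= r%:R + eta * E + (1 - lam)^-1.
    apply: sum_sup => n.
    apply: (@le_trans _ _ (\sum_(0 <= k < r + n) f k)).
      by rewrite [leRHS](@big_cat_nat _ _ _ n)//= ?leq_addl// lerDl sumr_ge0.
    rewrite (@big_cat_nat _ _ _ r)//= ?leq_addr// -addrA lerD//.
      rewrite (le_trans (ler_sum _ (fun k _ => f_le1 k)))//.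
      by rewrite big_const_nat subn0 iter_addr addr0.
    rewrite -{1}[r]add0n big_addn addKn.
    apply: (@le_trans _ _ (\sum_(0 <= k < n) (eta * f k + lam ^+ k))).
      by apply: ler_sum => k _; have := flam k; lra.
    rewrite big_split/= -mulr_sumr lerD ?ler_wpM2l ?(ltW eta_gt0)//.
    rewrite sum_geometric_lt1// ler_piMl ?invr_ge0 ?(ltW lam'0)//.
    by rewrite gerBl exprn_ge0.
  by move: EM r_le; lra.
have Ek : E * (1 - 2 * eta) * (1 - lam) <= 1 by rewrite -ler_pdivlMr// div1r.
have rk : r%:R * (1 - lam) <= 2 * eta.
  have h1 : r%:R * (1 - lam) <= eta * (E * (1 - lam)).
    by rewrite mulrA ler_wpM2r// ltW.
  have h2 : eta * (E * (1 - lam)) <= 12^-1 * (E * (1 - lam)).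
    by apply: ler_wpM2r; [rewrite mulr_ge0//; lra | lra].
  have h3 : eta * (E * (1 - lam)) <= eta * 2 by rewrite ler_wpM2l ?(ltW eta_gt0)//; lra.
  by lra.
have k_le : 1 - lam <= 2 * eta by apply: le_trans rk; rewrite ler_peMl// ltW.
have lam_gt0 : 0 < lam by lra.
have lamr : 1 - 2 * eta <= lam ^+ r.
  have /(bernoulli_sub r) : 0 <= 1 - lam <= 1 by apply/andP; split; lra.
  by rewrite subKr; lra.
(* Since [lam ^+ r >= 1 - 2 * eta], a bound [K * lam ^+ t] on [f t] reproduces itself after [r]
   steps as soon as [1 + eta * K <= K * (1 - 2 * eta)]; this [K] gives equality. *)
pose K := (1 - 3 * eta)^-1.
have K3 : K * (1 - 3 * eta) = 1 by rewrite mulVf// gt_eqF//; lra.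
have K0 : 0 < K by rewrite invr_gt0; lra.
have K1 : 1 <= K by nra.
have K4 : K <= 1 + 4 * eta.
  have : K <= (1 + 4 * eta) * (K * (1 - 3 * eta)).
    by rewrite mulrCA ler_peMr ?(ltW K0)//; nra.
  by rewrite K3 mulr1.
have K22 : K ^+ 2 <= 2.
  have : K <= 4 / 3 by lra.
  by rewrite expr2 => ?; nra.
have lam_le1 n : lam ^+ n <= 1 by apply: exprn_ile1; rewrite ltW.
have lam_anti t : (t < r)%N -> lam ^+ r <= lam ^+ t.
  by move=> tr; apply: ler_wiXn2l; [exact: ltW|exact: ltW|exact: ltnW].
have fK t : f t <= K * lam ^+ t.
  elim/ltn_ind: t => t IH; have [tr|rt] := ltnP t r.
    apply: le_trans (f_le1 t) _; have := lam_anti _ tr.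
    by have := K3; nra.
  rewrite -(subnK rt); set u := (t - r)%N.
  have uf : f u <= K * lam ^+ u by apply: IH; rewrite ltn_subrL r_gt0 (leq_trans r_gt0).
  have := flam u; rewrite exprD.
  have lu : 0 <= lam ^+ u by rewrite exprn_ge0.
  have ef : eta * f u <= eta * (K * lam ^+ u) by rewrite ler_wpM2l// ltW.
  have : (1 + eta * K) * lam ^+ u <= K * lam ^+ r * lam ^+ u.
    by rewrite ler_wpM2r//; have : K * (1 - 2 * eta) <= K * lam ^+ r;
      [rewrite ler_wpM2l// ltW | lra].
  by lra.
(* The same induction with [F_relax] closes because [K + eta * K ^+ 2 = K ^+ 2 * (1 - 2 * eta)]. *)
have FK t : F t <= K ^+ 2 * lam ^+ t.
  elim/ltn_ind: t => t IH; have [tr|rt] := ltnP t r.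
    apply: le_trans (F_le1 t) _; have := lam_anti _ tr.
    have : 1 <= K * lam ^+ r by nra.
    by rewrite expr2; nra.
  rewrite -(subnKC rt); set u := (t - r)%N.
  have uF : F u <= K ^+ 2 * lam ^+ u by apply: IH; rewrite ltn_subrL r_gt0 (leq_trans r_gt0).
  apply: le_trans (F_relax u) _; rewrite exprD.
  have lu : 0 <= lam ^+ u by rewrite exprn_ge0.
  have ef : eta * F u <= eta * (K ^+ 2 * lam ^+ u) by rewrite ler_wpM2l// ltW.
  have := fK u.
  have : (K + eta * K ^+ 2) * lam ^+ u <= K ^+ 2 * lam ^+ r * lam ^+ u.
    rewrite ler_wpM2r//; have : K ^+ 2 * (1 - 2 * eta) <= K ^+ 2 * lam ^+ r.
      by rewrite ler_wpM2l// sqr_ge0.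
    have : K ^+ 2 * (1 - 3 * eta) = K by rewrite expr2 -mulrA K3 mulr1.
    by lra.
  by lra.
(* The lower bound on [F] passes to [f] through [lam ^+ (r + t) <= F (r + t) <= eta * F t + f t]. *)
have fL t : (1 - 4 * eta) * lam ^+ t <= f t.
  have := F_relax t; have := lamF (r + t)%N; rewrite exprD.
  have lt0 : 0 <= lam ^+ t by rewrite exprn_ge0.
  have : eta * F t <= eta * (K ^+ 2 * lam ^+ t) by rewrite ler_wpM2l// ltW.
  have : eta * (K ^+ 2 * lam ^+ t) <= eta * (2 * lam ^+ t).
    by rewrite ler_wpM2l ?(ltW eta_gt0)// ler_wpM2r.
  have : (1 - 2 * eta) * lam ^+ t <= lam ^+ r * lam ^+ t by rewrite ler_wpM2r.
  by lra.
have fU t : f t <= (1 + 4 * eta) * lam ^+ t.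
  by apply: le_trans (fK t) _; rewrite ler_wpM2r// exprn_ge0.
exists lam; split; rewrite ?lam_gt0//; first by move=> t; rewrite fL fU.
apply/andP; split; last first.
  rewrite -ler_pdivlMr//; apply: sum_sup => n.
  apply: le_trans (ler_sum _ (fun k _ => fU k)) _.
  rewrite -mulr_sumr sum_geometric_lt1// ler_wpM2l//; first lra.
  by rewrite -[leRHS]mul1r ler_wpM2r ?invr_ge0 ?(ltW lam'0)// gerBl exprn_ge0.
have partial n : (1 - 4 * eta) * (1 - lam ^+ n) <= E * (1 - lam).
  rewrite -ler_pdivrMr// -mulrA -sum_geometric_lt1// mulr_sumr.
  by apply: le_trans (sum_le n); apply: ler_sum => k _.
have cv : (1 - 4 * eta) * (1 - lam ^+ n) @[n --> \oo] --> (1 - 4 * eta) * (1 - 0).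
  apply: cvgMl_tmp; apply: cvgB; first exact: cvg_cst.
  by apply: cvg_expr; rewrite ger0_norm.
rewrite subr0 mulr1 in cv.
rewrite -(cvg_lim _ cv)//; apply: limr_le; first exact: cvgP cv.
by apply: nearW => n.
Qed.

(** * Exit barriers and maximal cycles *)

Section Landscape.
Variables (R : realType) (X : finType) (H : X -> R) (q : X -> X -> R).
Hypothesis q_sym : forall a b, q a b = q b a.
Hypothesis q_irr : forall a b, exists s, path_from_to q a b s.

Lemma Phi_omega_ge (a : X) (s : seq X) v : v \in a :: s -> H v <= Phi_omega H a s.
Proof.
have base : H a <= Phi_omega H a s.
  by elim: s => //= z s IH; rewrite le_max IH orbT.
rewrite inE => /orP[/eqP->//|]; elim: s {base} => //= z s IH.
by rewrite inE le_max => /orP[/eqP->|/IH->]; rewrite ?lexx ?orbT.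
Qed.

Lemma exists_highest (a : X) (s : seq X) :
  exists2 v, v \in a :: s & all (fun z => H z <= H v) (a :: s).
Proof.
elim: s a => [|z s IH] a; first by exists a; rewrite ?mem_head//= lexx.
have [v vs /allP hv] := IH z; have [av|va] := leP (H a) (H v).
  exists v; first by rewrite inE vs orbT.
  by apply/allP => u; rewrite inE => /orP[/eqP->//|/hv].
exists a; first exact: mem_head.
apply/allP => w; rewrite inE => /orP[/eqP->//|/hv wv].
exact: le_trans wv (ltW va).
Qed.

Lemma path_crosses_boundary (C : {set X}) (a : X) (s : seq X) :
  path (qrel q) a s -> a \in C -> last a s \notin C ->
  exists2 u, u \in boundary q C & u \in a :: s.
Proof.
elim: s a => [|c s IH] a /=; first by move=> _ ->.
move=> /andP[ac ps] aC ls; have [cC|cC] := boolP (c \in C).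
  by have [u ub us] := IH _ ps cC ls; exists u; rewrite // inE us orbT.
exists c; last by rewrite !inE eqxx orbT.
by rewrite inE cC; apply/existsP; exists a; rewrite aC.
Qed.

Lemma exit_height_le (D : {set X}) (z : X) : D != finset.setT -> z \in D ->
  exists s, [/\ path (qrel q) z s, last z s \notin D &
    all (fun v => H v <= H z + Gtilde H q D) (z :: s)].
Proof.
move=> DT zD.
have [d dD] : exists d, d \notin D.
  apply/existsP; rewrite -negb_forall; apply: contra DT => /forallP h.
  by apply/eqP/setP => v; rewrite h inE.
have G0 : 0 <= Gtilde H q D.
  exact: bigmax_ge_id.
pose exits_below w := exists s,
  [/\ path (qrel q) z s, last z s \notin D & all (fun v => H v <= H w) (z :: s)].
have [w0 hw0] : exists w, exits_below w.
  have [s [ps ls]] := q_irr z d; have [w _ hw] := exists_highest z s.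
  by exists w, s; rewrite ls.
have w0P : `[< exits_below w0 >] by apply/asboolP.
(* [H w] is the communication height from [z] to the complement of [D]: [w] minimises [H] among the
   points that dominate some exit path. *)
case: (@arg_minP _ _ _ w0 (fun w => `[< exits_below w >]) H w0P) => w /asboolP[s [ps ls hs]] wmin.
have exit_ge t : path (qrel q) z t -> last z t \notin D -> exists2 v, v \in z :: t & H w <= H v.
  move=> pt lt; have [v vt hv] := exists_highest z t; exists v => //.
  by apply: wmin; apply/asboolP; exists t.
have [small|big] := leP (H w) (H z + Gtilde H q D).
  exists s; split => //; apply/allP => v /(allP hs) /le_trans; exact.
exfalso; have zw : H z < H w by apply: le_lt_trans big; rewrite lerDl.
pose e := [rel a b | [&& qrel q a b, H a < H w & H b < H w]].
have path_e a t : path (qrel q) a t -> (forall v, v \in a :: t -> H v < H w) -> path e a t.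
  elim: t a => //= c t IH a /andP[ac pt] low.
  have lowt v : v \in c :: t -> H v < H w by move=> vt; apply: low; rewrite inE vt orbT.
  by rewrite ac !low ?inE ?eqxx ?orbT//= IH.
have e_path a t : H a < H w -> path e a t ->
    path (qrel q) a t /\ (forall v, v \in a :: t -> H v < H w).
  elim: t a => [|c t IH] a alow /=; first by move=> _; split => // v; rewrite inE => /eqP->.
  move=> /andP[/and3P[ac _ clow] /(IH c clow)[pt low]]; split; first by rewrite ac.
  by move=> v; rewrite inE => /orP[/eqP->|/low].
have e_sym : connect_sym e.
  by apply: sym_connect_sym => a b; rewrite /= /qrel q_sym; congr (_ && _); exact: andbC.
(* If the barrier [H w] is too high, the component [C] of [z] below it is a maximal cycle. *)
pose C := [set v | connect e z v]%SET.
have zC : z \in C by rewrite inE connect0.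
have low v : v \in C -> H v < H w.
  by rewrite inE => /connectP[t pt ->]; apply: (e_path z t zw pt).2; exact: mem_last.
have CD : C \subset D.
  apply/fintype.subsetP => v; rewrite inE => /connectP[t pt ->]; apply/negPn/negP => lt.
  have [pt' lowt] := e_path _ _ zw pt.
  by have [u /lowt] := exit_ge _ pt' lt; rewrite ltNge => /negP.
have step a b : a \in C -> 0 < q a b -> H b < H w -> b \in C.
  move=> aC ab bw; move: (aC); rewrite !inE => /connect_trans; apply.
  by apply: connect1; rewrite /= /qrel ab low.
have bnd v : v \in boundary q C -> H w <= H v.
  rewrite inE => /andP[vC /existsP[a /andP[aC av]]]; rewrite leNgt; apply: contra vC.
  exact: step aC av.
have C_gt0 : (0 < #|C|)%N by rewrite card_gt0; apply/set0Pn; exists z.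
have Ccycle : is_cycle H q C.
  have [C1|C1] := leqP #|C| 1; first by left; apply/eqP; rewrite eqn_leq C1.
  right; split; last by move=> a b aC /bnd; apply: lt_le_trans; exact: low.
  split=> // a b aC bC.
  have : connect e a b.
    by move: aC bC; rewrite !inE e_sym; exact: connect_trans.
  move=> /connectP[t pt bt]; have [pt' lowt] := e_path _ _ (low _ aC) pt.
  exists t; split; first by split.
  elim: t a aC pt {bt pt' lowt} => //= c t IH a aC /andP[ac pt].
  have cC : c \in C by case/and3P: ac => ac _; exact: step aC ac.
  by rewrite cC (IH c).
(* The exit path [s] leaves a larger cycle [C'] inside [D] through a boundary point of height at
   most [H w]. A connected cycle lies strictly below its boundary, hence below [H w], and
   connectivity puts it in [C]. *)
have Cmax : max_cycle_in H q D C.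
  split=> // C' C'cycle CC' C'D; apply/eqP; rewrite finset.eqEsubset CC' andbT.
  have zC' : z \in C' by exact: (fintype.subsetP CC').
  case: C'cycle => [/eqP/cards1P[a C'a]|[[_ C'conn] C'bnd]].
    by rewrite C'a finset.sub1set; move: zC'; rewrite C'a inE => /eqP <-.
  have C'low v : v \in C' -> H v < H w.
    move=> vC'; suff [u ub uw] : exists2 u, u \in boundary q C' & H u <= H w.
      exact: lt_le_trans (C'bnd _ _ vC' ub) uw.
    have lC' : last z s \notin C' by apply: contra ls; exact: (fintype.subsetP C'D).
    by have [u ub /(allP hs)] := path_crosses_boundary ps zC' lC'; exists u.
  apply/fintype.subsetP => v vC'; have [t [[pt tv] /allP tC']] := C'conn _ _ zC' vC'.
  rewrite inE; apply/connectP; exists t => //; apply: path_e => // u.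
  by rewrite inE => /orP[/eqP->//|/tC' /C'low].
(* A path from [C] to its complement that stayed below [H w] would end in [C], so it reaches [H w].
   The point [d] and irreducibility ensure that the infima are over nonempty sets. *)
have depthC : H w - H z <= depth H q C.
  apply: lerB.
    have cC : exists c, c \notin C by exists d; apply: contra dD; exact: (fintype.subsetP CD).
    have [c cC'] := cC.
    apply: lb_le_inf; first by exists (Phi H q z c), z, c; split; rewrite ?finset.in_setC.
    move=> _ [a [b [aC bC ->]]]; apply: lb_le_inf.
      by have [t pt] := q_irr a b; exists (Phi_omega H a t), t.
    move=> _ [t [[pt tb] ->]].
    have [u ut hu] := exists_highest a t; apply: le_trans (Phi_omega_ge ut).
    rewrite leNgt; apply/negP => uw; move: bC; rewrite inE => /negP; apply.
    rewrite inE; have := aC; rewrite inE => /connect_trans; apply.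
    apply/connectP; exists t => //; apply: path_e => // v /(allP hu) vu.
    exact: le_lt_trans uw.
  apply: ge_inf; last by exists z.
  exists (\big[Num.min/H z]_v H v) => _ [v vC ->]; exact: bigmin_le_cond.
have : depth H q C <= Gtilde H q D.
  by apply: le_bigmax_cond; apply/asboolP.
by move=> /(le_trans depthC); rewrite lerBlDl leNgt big.
Qed.
End Landscape.

(** Erasing loops from the path of [exit_height_le] keeps its end and its height bound, and makes
    its length at most [#|X|], which enters the Poincare constant. *)
Lemma exit_path (R : realType) (X : finType) (H : X -> R) (q : X -> X -> R) (A : {set X})
    (q_sym : forall a b, q a b = q b a)
    (q_irr : forall a b, exists s, path_from_to q a b s) (y : X) :
  A != finset.set0 -> y \notin A ->
  exists s, [/\ path (qrel q) y s, last y s \in A, (size s <= #|X|)%N &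
    all (fun v => H v <= H y + Gtilde H q (~: A)) (y :: s)].
Proof.
move=> A0 yA.
have DT : ~: A != finset.setT by apply: contra A0; rewrite -finset.setC0 => /eqP/finset.setC_inj->.
have yD : y \in ~: A by rewrite finset.in_setC.
have [s [ps + hs]] := exit_height_le H q_sym q_irr DT yD.
rewrite finset.in_setC negbK.
case/shortenP: ps hs => s' ps' us' ss' /allP hs ls'; exists s'; split => //.
  by have := max_card (mem (y :: s')); rewrite (card_uniqP us') => /ltnW.
apply/allP => v; rewrite inE => vs; apply: hs; rewrite inE.
by case/orP: vs => [->//|/ss' ->]; rewrite orbT.
Qed.

(** * Survival bound from the Poincare inequality *)

Section MetropolisChain.
Variables (R : realType) (X : finType) (H : X -> R) (q : X -> X -> R).
Hypothesis q_ge0 : forall a b, 0 <= q a b.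
Hypothesis q_stoch : forall a, \sum_(b : X) q a b = 1.

Section FixedTemperature.
Variable b : R.
Hypothesis b_gt0 : 0 < b.
Notation P := (Pmet H q b).

Lemma Pmet_sum1 a : \sum_c P a c = 1.
Proof.
rewrite (bigD1 a)//= /Pmet eqxx -[RHS](subrK (\sum_(z | z != a) q a z * expR (- (b * Num.max 0 (H z - H a))))).
by congr (_ + _); apply: eq_bigr => c ca; rewrite eq_sym (negbTE ca).
Qed.

Lemma Pmet_ge0 a c : 0 <= P a c.
Proof.
rewrite /Pmet; case: ifP => _; last by rewrite mulr_ge0 ?expR_ge0.
rewrite subr_ge0 -(q_stoch a) [leRHS](bigD1 a)//= ler_wpDl//.
apply: ler_sum => z _; rewrite ler_piMr// -[leRHS]expR0 ler_expR.
by rewrite oppr_le0 mulr_ge0 ?(ltW b_gt0)// le_max lexx.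
Qed.

Lemma survS A t y :
  surv H q b A t.+1 y = \sum_(z | z \notin A) P y z * surv H q b A t z.
Proof. by []. Qed.

Lemma surv_ge0 A t y : 0 <= surv H q b A t y.
Proof.
elim: t y => [|t IH] y //=.
by apply: sumr_ge0 => z _; rewrite mulr_ge0 ?Pmet_ge0.
Qed.

Lemma sum_Pmet_le1 (Q : pred X) a : \sum_(c | Q c) P a c <= 1.
Proof.
rewrite -(Pmet_sum1 a) [leRHS](bigID Q)/= lerDl.
by apply: sumr_ge0 => z _; exact: Pmet_ge0.
Qed.

Lemma surv_le1 A t y : surv H q b A t y <= 1.
Proof.
elim: t y => [|t IH] y //=; apply: le_trans (sum_Pmet_le1 (fun z => z \notin A) y).
by apply: ler_sum => z _; rewrite ler_piMr ?Pmet_ge0.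
Qed.

Lemma surv_anti A t y : surv H q b A t.+1 y <= surv H q b A t y.
Proof.
elim: t y => [|t IH] y; first exact: surv_le1.
by apply: ler_sum => z _; rewrite ler_wpM2l ?Pmet_ge0 ?IH.
Qed.

(** * Reversibility, Dirichlet form and decay of the killed mass *)

Hypothesis q_sym : forall a b, q a b = q b a.
Let w a := expR (- (b * H a)).

(** [w] is the unnormalised Gibbs measure. The flow across an edge sees the energies only through
    the higher endpoint, whence detailed balance. *)
Lemma Pmet_flow a c : a != c ->
  w a * P a c = q a c * expR (- (b * Num.max (H a) (H c))).
Proof.
move=> /negbTE ac; rewrite /Pmet ac mulrCA -expRD; congr (_ * expR _).
by case: (leP (H a) (H c)) => h; [rewrite (max_idPr _) ?subr_ge0// | rewrite (max_idPl _) ?subr_le0 ?ltW//]; ring.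
Qed.

Lemma Pmet_reversible a c : w a * P a c = w c * P c a.
Proof.
have [->//|ac] := eqVneq a c.
by rewrite !Pmet_flow// 1?eq_sym// q_sym maxC.
Qed.

(** Twice the usual Dirichlet form in L^2([w]): ordered pairs are summed without the factor 1/2. *)
Definition dirichlet (g : X -> R) : R :=
  \sum_a \sum_c w a * P a c * (g a - g c) ^+ 2.

(** When the square is expanded, both square terms give the norm of [g], one by stochasticity and
    the other by reversibility. The right side is 2 <g, (1 - P) g> in L^2([w]). *)
Lemma dirichletE g : dirichlet g =
  2 * (\sum_a w a * g a ^+ 2 - \sum_a \sum_c w a * P a c * g a * g c).
Proof.
have s1 : \sum_a \sum_c w a * P a c * g a ^+ 2 = \sum_a w a * g a ^+ 2.
  by apply: eq_bigr => a _; rewrite -mulr_suml -mulr_sumr Pmet_sum1 mulr1.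
have s2 : \sum_a \sum_c w a * P a c * g c ^+ 2 = \sum_a w a * g a ^+ 2.
  rewrite exchange_big -s1; apply: eq_bigr => a _; apply: eq_bigr => c _.
  by rewrite Pmet_reversible.
transitivity (\sum_a \sum_c w a * P a c * g a ^+ 2 + \sum_a \sum_c w a * P a c * g c ^+ 2
   - 2 * \sum_a \sum_c w a * P a c * g a * g c); last by rewrite s1 s2; ring.
rewrite mulr_sumr -big_split -sumrB; apply: eq_bigr => a _ /=.
by rewrite mulr_sumr -big_split -sumrB; apply: eq_bigr => c _ /=; ring.
Qed.

(** Only the term of the pair [a], [c] is kept; its conductance is at least
    [q0 * expR (- (b * M))]. *)
Lemma edge_dirichlet_le q0 M g a c : 0 <= q0 -> q0 <= q a c -> H a <= M -> H c <= M ->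
  q0 * expR (- (b * M)) * (g a - g c) ^+ 2 <= dirichlet g.
Proof.
move=> q00 qac aM cM; have [->|ac] := eqVneq a c.
  rewrite subrr expr0n/= mulr0; apply: sumr_ge0 => d _; apply: sumr_ge0 => e _.
  by rewrite mulr_ge0 ?sqr_ge0// mulr_ge0 ?expR_ge0 ?Pmet_ge0.
have pos d e : 0 <= w d * P d e * (g d - g e) ^+ 2.
  by rewrite mulr_ge0 ?sqr_ge0// mulr_ge0 ?expR_ge0 ?Pmet_ge0.
rewrite /dirichlet (bigD1 a)//= (bigD1 c)//= -addrA ler_wpDr//.
  by rewrite addr_ge0 ?sumr_ge0// => d _; rewrite sumr_ge0.
rewrite Pmet_flow// ler_wpM2r ?sqr_ge0// ler_pM ?expR_ge0//.
by rewrite ler_expR lerN2 ler_wpM2l ?(ltW b_gt0)// ge_max aM.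
Qed.

Lemma path_diff_le (e : rel X) (Q : pred X) (g : X -> R) L y s :
  (forall a c, e a c -> Q a -> Q c -> `|g a - g c| <= L) -> path e y s -> all Q (y :: s) ->
  `|g y - g (last y s)| <= (size s)%:R * L.
Proof.
move=> hL; elim: s y => [|c s IH] y /=; first by rewrite subrr normr0 mul0r.
move=> /andP[yc cs] /and3P[Qy Qc Qs].
have := IH c cs; rewrite /= Qc Qs => /(_ isT) h.
rewrite -(subrK (g c) (g y)) -addrA -natr1 mulrDl mul1r addrC.
by rewrite (le_trans (ler_normD _ _))// lerD// hL.
Qed.

(** Since [g] vanishes on [A], [g y] is the sum of its increments along an exit path. The path stays
    below [H y + G], so [expR (b * H y)] cancels against [w y] and only [expR (b * G)] remains. Two
    powers of [#|X|] come from the path length, the third from the sum over [y]. *)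
Lemma poincare_inequality q0 (A : {set X}) G (g : X -> R) : 0 < q0 ->
    (forall a c, 0 < q a c -> q0 <= q a c) -> (forall a, a \in A -> g a = 0) ->
    (forall y, y \notin A -> exists s, [/\ path (qrel q) y s, last y s \in A,
       (size s <= #|X|)%N & all (fun v => H v <= H y + G) (y :: s)]) ->
  \sum_a w a * g a ^+ 2 <= #|X|%:R ^+ 3 / q0 * expR (b * G) * dirichlet g.
Proof.
move=> q00 hq0 gA exit.
have dg0 : 0 <= dirichlet g.
  apply: sumr_ge0 => d _; apply: sumr_ge0 => e _.
  by rewrite mulr_ge0 ?sqr_ge0// mulr_ge0 ?expR_ge0 ?Pmet_ge0.
apply: (@le_trans _ _ (\sum_(a : X) #|X|%:R ^+ 2 / q0 * expR (b * G) * dirichlet g)); last first.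
  rewrite big_const iter_addr addr0 -[leLHS]mulr_natr cardT -cardE.
  by rewrite le_eqVlt; apply/orP; left; apply/eqP; ring.
apply: ler_sum => y _; have [yA|yA] := boolP (y \in A).
  rewrite gA// expr0n/= mulr0 !mulr_ge0 ?expR_ge0 ?exprn_ge0 ?invr_ge0// ltW//.
have [s [ps ls ss hs]] := exit y yA.
(* [L] is the bound of [edge_dirichlet_le] on one increment, with [M] equal to [H y + G]. *)
pose L := Num.sqrt (dirichlet g * expR (b * (H y + G)) / q0).
have L2 : L ^+ 2 = dirichlet g * expR (b * (H y + G)) / q0.
  by rewrite sqr_sqrtr// !mulr_ge0 ?expR_ge0// invr_ge0 ltW.
have := path_diff_le (g := g) (L := L) _ ps hs; rewrite (gA _ ls) subr0 => gy.
have {}gy : `|g y| <= #|X|%:R * L.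
  apply: le_trans (gy _) _; last by rewrite ler_wpM2r ?sqrtr_ge0 ?ler_nat.
  move=> a c ac aM cM; rewrite -(ler_pXn2r (ltn0Sn 1)) ?nnegrE ?sqrtr_ge0// L2.
  have := edge_dirichlet_le g (ltW q00) (hq0 _ _ ac) aM cM.
  rewrite real_normK ?num_real// ler_pdivlMr// => h.
  rewrite -(ler_pM2r (expR_gt0 (- (b * (H y + G))))) -[leRHS]mulrA -expRD subrr expR0 mulr1.
  by apply: le_trans h; rewrite le_eqVlt; apply/orP; left; apply/eqP; ring.
have g2 : g y ^+ 2 <= #|X|%:R ^+ 2 * L ^+ 2.
  by rewrite -exprMn -real_normK ?num_real// ler_pXn2r ?nnegrE ?mulr_ge0 ?sqrtr_ge0.
rewrite L2 mulrDr expRD in g2.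
apply: le_trans (ler_wpM2l (expR_ge0 _) g2) _.
have we : w y * expR (b * H y) = 1 by rewrite -expRD addNr expR0.
by rewrite le_eqVlt; apply/orP; left; apply/eqP; rewrite -[RHS]mul1r -we /w; ring.
Qed.

(* [surv_mass A t] is <1, P_A^t 1> in L^2(w); as P_A is self-adjoint there, it controls
   the squared norm of the survival function at half the time. *)
Definition surv_mass (A : {set X}) t := \sum_(y | y \notin A) w y * surv H q b A t y.

(** Detailed balance moves the steps of the killed chain one by one from the first factor to the
    second. *)
Lemma surv_massD (A : {set X}) s t :
  \sum_(y | y \notin A) w y * surv H q b A s y * surv H q b A t y = surv_mass A (s + t).
Proof.
elim: s t => [|s IH] t.
  by apply: eq_bigr => y _; rewrite mulr1.
rewrite addSnnS -IH.
under eq_bigr do rewrite survS mulr_sumr mulr_suml.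
rewrite exchange_big; apply: eq_bigr => z _.
rewrite survS mulr_sumr; apply: eq_bigr => y _.
transitivity (w y * P y z * (surv H q b A s z * surv H q b A t y)); first by ring.
by rewrite Pmet_reversible; ring.
Qed.

(** The Poincare inequality is applied to the survival function at time [t], set to 0 on [A]: by
    [surv_massD] its squared norm is [surv_mass A (2 * t)], and its Dirichlet form is twice the mass
    lost in the next step. *)
Lemma surv_mass_decay (A : {set X}) C t : 0 < C ->
    (forall g, (forall a, a \in A -> g a = 0) -> \sum_a w a * g a ^+ 2 <= C * dirichlet g) ->
  surv_mass A (2 * t.+1) <= (1 - (2 * C)^-1) * surv_mass A (2 * t).
Proof.
move=> C0 poincare; pose g y := if y \in A then 0 else surv H q b A t y.
have gE y : g y ^+ 2 = if y \notin A then surv H q b A t y ^+ 2 else 0.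
  by rewrite /g; case: (y \in A); rewrite ?expr0n.
have s1 : \sum_a w a * g a ^+ 2 = surv_mass A (2 * t).
  rewrite mul2n -addnn -surv_massD big_mkcond [RHS]big_mkcond/=; apply: eq_bigr => a _.
  by rewrite gE; case: (a \in A); rewrite ?mulr0// expr2 mulrA.
have s2 : \sum_a \sum_c w a * P a c * g a * g c = surv_mass A (2 * t).+1.
  rewrite mul2n -addnn -addnS -surv_massD [RHS]big_mkcond; apply: eq_bigr => a _.
  rewrite /g; case: (a \in A); first by rewrite big1// => c _; rewrite mulr0 mul0r.
  rewrite survS mulr_sumr [RHS]big_mkcond/=; apply: eq_bigr => c _.
  by case: (c \in A) => /=; rewrite ?mulr0//; ring.
have anti : surv_mass A (2 * t.+1) <= surv_mass A (2 * t).+1.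
  by rewrite mulnS add2n; apply: ler_sum => y _; rewrite ler_wpM2l ?expR_ge0 ?surv_anti.
apply: le_trans anti _.
have := poincare g; rewrite dirichletE s1 s2 => /(_ _) h.
have {}h : surv_mass A (2 * t) <= C * (2 * (surv_mass A (2 * t) - surv_mass A (2 * t).+1)).
  by apply: h => a aA; rewrite /g aA.
have i0 : 0 < (2 * C)^-1 by rewrite invr_gt0 mulr_gt0.
have : (2 * C)^-1 * surv_mass A (2 * t) <= surv_mass A (2 * t) - surv_mass A (2 * t).+1.
  by rewrite mulrC ler_pdivrMr ?mulr_gt0//; lra.
by lra.
Qed.

End FixedTemperature.
End MetropolisChain.

(** Iteration of [surv_mass_decay], with [C] and [K] independent of [b]. The factor
    [expR (K * (1 + b))] pays for the initial mass and for dividing by the Gibbs weight of [y]. *)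
Lemma survival_bound (R : realType) (X : finType) (H : X -> R) (q : X -> X -> R)
    (q_ge0 : forall a b, 0 <= q a b) (q_stoch : forall a, \sum_(b : X) q a b = 1)
    (q_sym : forall a b, q a b = q b a)
    (q_irr : forall a b, exists s, path_from_to q a b s) (A : {set X}) :
  A != finset.set0 ->
  exists C K : R, [/\ 1 <= C, 0 <= K & forall b t y, 0 < b -> y \notin A ->
    surv H q b A (2 * t) y <=
      expR (K * (1 + b) - t%:R / (C * expR (b * Gtilde H q (~: A))))].
Proof.
move=> A0; set G := Gtilde H q (~: A).
have G0 : 0 <= G by exact: bigmax_ge_id.
pose q0 := \big[Num.min/1]_(p : X * X | 0 < q p.1 p.2) q p.1 p.2.
have q0_gt0 : 0 < q0 by apply: lt_bigmin.
have q0_le1 : q0 <= 1 by exact: bigmin_le_id.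
have q0_le a c : 0 < q a c -> q0 <= q a c.
  by move=> ac; apply: (@bigmin_le_cond _ _ _ _ (a, c)).
pose h := \big[Num.max/0]_y `|H y|.
have h_ge y : `|H y| <= h by exact: le_bigmax_cond.
have h0 : 0 <= h by exact: bigmax_ge_id.
have [a aA] : exists a, a \in A by exact/set0Pn.
have X1 : 1 <= #|X|%:R :> R by rewrite (ler_nat _ 1); apply/card_gt0P; exists a.
have C1 : 1 <= #|X|%:R ^+ 3 / q0 by rewrite ler_pdivlMr// mul1r (le_trans q0_le1)// exprn_ege1.
exists (2 * (#|X|%:R ^+ 3 / q0)), (2 * h + #|X|%:R); split; [lra|lra|].
move=> b t y b0 yA; set C := #|X|%:R ^+ 3 / q0 * expR (b * G).
have C_ge1 : 1 <= C.
  by rewrite -[1]mulr1 ler_pM// -[leLHS]expR0 ler_expR mulr_ge0// ltW.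
have C_gt0 : 0 < C by lra.
have i01 : (2 * C)^-1 <= 1 by rewrite invf_le1//; lra.
have decay n : surv_mass H q b A (2 * n) <= (1 - (2 * C)^-1) ^+ n * surv_mass H q b A 0.
  elim: n => [|n IH]; first by rewrite muln0 expr0 mul1r.
  apply: le_trans (surv_mass_decay q_ge0 q_stoch b0 q_sym (C := C) n C_gt0 _) _.
    move=> g gA; apply: (poincare_inequality q_ge0 q_stoch b0 q0_gt0 q0_le gA).
    by move=> z zA; exact: exit_path.
  by rewrite exprS -mulrA ler_wpM2l// subr_ge0.
have mass0 : surv_mass H q b A 0 <= #|X|%:R * expR (b * h).
  rewrite /surv_mass big_mkcond; apply: (@le_trans _ _ (\sum_(z : X) expR (b * h))).
    apply: ler_sum => z _; case: ifP => _; last exact: expR_ge0.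
    rewrite mulr1 ler_expR -mulrN ler_wpM2l ?(ltW b0)// (le_trans _ (h_ge z))//.
    by rewrite lerNl lerNnormlW.
  by rewrite sumr_const -[leLHS]mulr_natl.
have term : expR (- (b * H y)) * surv H q b A (2 * t) y <= surv_mass H q b A (2 * t).
  rewrite /surv_mass (bigD1 y)//= lerDl sumr_ge0// => z _.
  by rewrite mulr_ge0 ?expR_ge0 ?surv_ge0.
have bound : surv H q b A (2 * t) y <=
    expR (b * H y) * ((1 - (2 * C)^-1) ^+ t * (#|X|%:R * expR (b * h))).
  rewrite -(ler_pM2l (expR_gt0 (- (b * H y)))) mulrA -expRD addNr expR0 mul1r.
  apply: le_trans term _; apply: le_trans (decay t) _.
  by rewrite ler_wpM2l// exprn_ge0// subr_ge0.
apply: le_trans bound _; rewrite expRD mulrCA mulrC.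
apply: ler_pM; rewrite ?mulr_ge0 ?expR_ge0 ?exprn_ge0 ?subr_ge0//.
  have Xe : #|X|%:R <= expR #|X|%:R :> R by apply: le_trans (expR_ge1Dx _); lra.
  apply: (@le_trans _ _ (expR (b * h) * (expR #|X|%:R * expR (b * h)))).
    rewrite ler_pM ?mulr_ge0 ?expR_ge0 ?ler_wpM2r ?expR_ge0//.
    by rewrite ler_expR ler_wpM2l ?(ltW b0)// (le_trans (ler_norm _))// h_ge.
  by rewrite -!expRD ler_expR; nra.
have -> : - (t%:R / (2 * (#|X|%:R ^+ 3 / q0) * expR (b * G))) = t%:R * - (2 * C)^-1.
  by rewrite mulrN /C !mulrA.
rewrite expRM_natl; apply: lerXn2r; rewrite ?nnegrE ?expR_ge0 ?subr_ge0//.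
exact: expR_ge1Dx.
Qed.

(** * Regeneration at x *)

Section Regeneration.
Variables (R : realType) (X : finType) (H : X -> R) (q : X -> X -> R) (b : R).
Hypothesis q_ge0 : forall a b, 0 <= q a b.
Hypothesis q_stoch : forall a, \sum_(b : X) q a b = 1.
Hypothesis b_gt0 : 0 < b.
Variables (A : {set X}) (x : X).
Hypothesis xA : x \notin A.
Let P_ge0 := Pmet_ge0 H q_ge0 q_stoch b_gt0.
Let S_ge0 := surv_ge0 H q_ge0 q_stoch b_gt0.
Let S_le1 := surv_le1 H q_ge0 q_stoch b_gt0.
Let S_anti := surv_anti H q_ge0 q_stoch b_gt0.
Let P_le1 := sum_Pmet_le1 H q_ge0 q_stoch b_gt0.
Local Notation S := (surv H q b).
Local Notation P := (Pmet H q b).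

Definition max_surv t := \big[Num.max/0]_(y | y \notin A) S A t y.

Lemma surv_le_max t y : y \notin A -> S A t y <= max_surv t.
Proof. by move=> yA; exact: le_bigmax_cond. Qed.

Lemma max_surv_ge0 t : 0 <= max_surv t.
Proof. exact: bigmax_ge_id. Qed.

Lemma max_surv_le t c : 0 <= c -> (forall y, y \notin A -> S A t y <= c) -> max_surv t <= c.
Proof. by move=> c0 h; apply: bigmax_le. Qed.

Lemma survD_le t u y : y \notin A -> S A (t + u) y <= S A t y * max_surv u.
Proof.
elim: t y => [|t IH] y yA; first by rewrite mul1r surv_le_max.
rewrite addSn !survS mulr_suml; apply: ler_sum => z zA.
by rewrite -mulrA ler_wpM2l ?P_ge0 ?IH.
Qed.

Lemma max_surv_sub t u : max_surv (t + u) <= max_surv t * max_surv u.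
Proof.
apply: max_surv_le => [|y yA]; first by rewrite mulr_ge0 ?max_surv_ge0.
by apply: le_trans (survD_le _ _ yA) _; rewrite ler_wpM2r ?max_surv_ge0 ?surv_le_max.
Qed.

Lemma sum_notin_setU1 (F : X -> R) :
  \sum_(z | z \notin A) F z = F x + \sum_(z | z \notin A :|: [set x]%SET) F z.
Proof.
rewrite (bigD1 x)//=; congr (_ + _); apply: eq_bigl => z.
by rewrite !inE negb_or.
Qed.

(** Markov property at the first visit to [A :|: [set x]]: either it has not occurred by time [r],
    and [u] more steps are survived with probability at most [max_surv u], or the chain was at [x]
    with at least [u] steps left to survive. *)
Lemma surv_le_absorb r u y : y \notin A ->
  S A (r + u) y <= S (A :|: [set x]%SET) r y * max_surv u + S A u x.
Proof.
elim: r y => [|r IH] y yA.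
  by rewrite mul1r ler_wpDr ?S_ge0 ?surv_le_max.
rewrite addSn survS sum_notin_setU1.
have Px : P y x * S A (r + u) x <= P y x * S A u x.
  rewrite ler_wpM2l ?P_ge0//; elim: (r) => [//|n hn].
  by rewrite addSn (le_trans (S_anti _ _ _)).
have Ps : \sum_(z | z \notin A :|: [set x]%SET) P y z * S A (r + u) z <=
    S (A :|: [set x]%SET) r.+1 y * max_surv u
     + (\sum_(z | z \notin A :|: [set x]%SET) P y z) * S A u x.
  rewrite survS !mulr_suml -big_split/=; apply: ler_sum => z zA.
  rewrite -mulrA -mulrDr ler_wpM2l ?P_ge0// IH//.
  by apply: contra zA; rewrite inE => ->.
have : (P y x + \sum_(z | z \notin A :|: [set x]%SET) P y z) * S A u x <= S A u x.
  by rewrite -(sum_notin_setU1 (P y)) ler_piMl ?S_ge0 ?P_le1.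
by move: Px Ps; lra.
Qed.

(** The difference is the probability that within [r] steps [x] is visited and [A] is not; after
    that visit, surviving [u] further steps is enough. *)
Lemma surv_ge_return r u y :
  (S A r y - S (A :|: [set x]%SET) r y) * S A u x <= S A u y.
Proof.
elim: r y => [|r IH] y; first by rewrite subrr mul0r S_ge0.
apply: le_trans (S_anti _ _ _); rewrite !survS !sum_notin_setU1 -addrA mulrDl -sumrB.
apply: lerD; first by rewrite -mulrA ler_wpM2l ?P_ge0// ler_piMl ?S_ge0.
rewrite mulr_suml; apply: ler_sum => z _.
by rewrite -mulrBr -mulrA ler_wpM2l ?P_ge0.
Qed.

(** Markov property at time [t], then [surv_ge_return] from the current point: up to [delta] times
    the probability of being alive at [t], a chain alive at [t + r] has met [x] at time [t] or
    later. *)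
Lemma surv_supermultiplicative r delta : 0 <= delta ->
    (forall y, y \notin A :|: [set x]%SET -> S (A :|: [set x]%SET) r y <= delta) ->
  forall t u y, y \notin A ->
    (S A (t + r) y - delta * S A t y) * S A u x <= S A (t + u) y.
Proof.
move=> d0 hd; elim=> [|t IH] u y yA.
  (* [hd] does not cover a start at [x], but there [S A r x <= 1] and [0 <= delta] suffice. *)
  rewrite mulr1 !add0n; have [->|yx] := eqVneq y x.
    by rewrite ler_piMl ?S_ge0// lerBlDr ler_wpDr ?S_le1.
  apply: le_trans (surv_ge_return r u y); rewrite ler_wpM2r ?S_ge0// lerB// hd//.
  by rewrite !inE negb_or yA.
rewrite !addSn !survS mulr_sumr -sumrB mulr_suml; apply: ler_sum => z zA.
by rewrite mulrCA -mulrBr -mulrA ler_wpM2l ?P_ge0 ?IH.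
Qed.

End Regeneration.

(** * Mean hitting time and exponential tails *)

Lemma mulrn_geometric_le (R : realType) (s : R) n : 0 < s < 1 -> n%:R * s ^+ n <= (1 - s)^-1.
Proof.
move=> /andP[s0 s1]; apply: (@le_trans _ _ (\sum_(0 <= k < n) s ^+ k)).
  have -> : n%:R * s ^+ n = \sum_(0 <= k < n) s ^+ n.
    by rewrite big_const_nat subn0 iter_addr addr0 mulr_natl.
  apply: ler_sum_nat => k /andP[_ kn].
  by apply: ler_wiXn2l; [exact: ltW|exact: ltW|exact: ltnW].
rewrite sum_geometric_lt1// ler_piMl ?invr_ge0 ?subr_ge0 ?(ltW s1)//.
by rewrite gerBl exprn_ge0// ltW.
Qed.

Lemma abel_summation (R : realType) (f : nat -> R) n :
  \sum_(0 <= k < n.+1) k%:R * (f k.-1 - f k) = \sum_(0 <= k < n) f k - n%:R * f n.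
Proof.
elim: n => [|n IH]; first by rewrite big_nat1 big_geq// !mul0r subr0.
by rewrite big_nat_recr//= IH [in RHS]big_nat_recr//= -natr1; ring.
Qed.

(** The decay carries two factors [s ^+ n]: one keeps [n%:R * s ^+ n] bounded, the other sends the
    boundary term [n%:R * f n] of the Abel summation to 0. The mean thus becomes the supremum of the
    partial sums of [f], the form used by [near_geometric_survival]. *)
Lemma mean_is_tail_sum (R : realType) (f : nat -> R) (c s : R) :
    (forall n, 0 <= f n <= c * s ^+ n * s ^+ n) -> 0 < s < 1 -> 0 <= c ->
  let E := limn (fun n => \sum_(0 <= k < n) k%:R * (f k.-1 - f k)) in
  (forall n, \sum_(0 <= k < n) f k <= E) /\
  (forall M, (forall n, \sum_(0 <= k < n) f k <= M) -> E <= M).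
Proof.
move=> hf s01 c0 E; have /andP[s0 s1] := s01.
pose S n := \sum_(0 <= k < n) f k.
have S_nd : nondecreasing_seq S.
  apply/nondecreasing_seqP => n; rewrite /S big_nat_recr//= lerDl.
  by case/andP: (hf n).
have sX n : s ^+ n <= 1 by apply: exprn_ile1; exact: ltW.
have S_ub n : S n <= c * (1 - s)^-1.
  apply: (@le_trans _ _ (\sum_(0 <= k < n) c * s ^+ k)).
    apply: ler_sum => k _; case/andP: (hf k) => _ /le_trans; apply.
    by rewrite ler_piMr// mulr_ge0// exprn_ge0// ltW.
  rewrite -mulr_sumr ler_wpM2l// sum_geometric_lt1// ler_piMl ?invr_ge0 ?subr_ge0 ?(ltW s1)//.
  by rewrite gerBl exprn_ge0// ltW.
have S_cvg : cvgn S.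
  apply: nondecreasing_is_cvgn => //; exists (c * (1 - s)^-1) => _ [n _ <-]; exact: S_ub.
have nf0 : n%:R * f n @[n --> \oo] --> (0 : R).
  apply: (@squeeze_cvgr _ _ _ _ (fun=> 0) (fun n => c * (1 - s)^-1 * s ^+ n)).
  - apply: nearW => n; case/andP: (hf n) => f0 fle.
    rewrite mulr_ge0//=; apply: le_trans (ler_wpM2l (ler0n _ n) fle) _.
    rewrite mulrA ler_wpM2r ?exprn_ge0 ?(ltW s0)// mulrCA ler_wpM2l//.
    exact: mulrn_geometric_le.
  - exact: cvg_cst.
  - have s_to0 : s ^+ n @[n --> \oo] --> (0 : R).
      by apply: cvg_expr; rewrite ger0_norm// ltW.
    have h := cvgMl_tmp (a := c * (1 - s)^-1) s_to0; rewrite mulr0 in h; exact: h.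
have EE : E = limn S.
  apply: (@cvg_lim _ (@norm_hausdorff _ R)).
  rewrite -(cvg_shiftS (fun n => \sum_(0 <= k < n) k%:R * (f k.-1 - f k))).
  under eq_fun do rewrite abel_summation.
  by have h := cvgB S_cvg nf0; rewrite subr0 in h; exact: h.
rewrite EE; split => [n|M hM]; first exact: nondecreasing_cvgn_le.
by apply: limr_le => //; apply: nearW.
Qed.

Lemma expRN_dist_le (R : realType) (u v m d : R) : m <= u -> m <= v -> `|u - v| <= d ->
  `|expR (- u) - expR (- v)| <= d * expR (- m).
Proof.
wlog uv : u v / u <= v.
  move=> hw mu mv duv; have [uv|vu] := leP u v; first exact: hw.
  by rewrite distrC hw// 1?distrC// ltW.
move=> mu mv; rewrite distrC ger0_norm ?subr_ge0// => duv.
have e : expR (- v) = expR (- u) * expR (u - v) by rewrite -expRD; congr expR; ring.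
rewrite e ger0_norm; last by rewrite subr_ge0 ler_piMr ?expR_ge0// -[leRHS]expR0 ler_expR subr_le0.
rewrite -[X in X - _]mulr1 -mulrBr mulrC; apply: ler_pM; rewrite ?expR_ge0//.
- by rewrite subr_ge0 -[leRHS]expR0 ler_expR subr_le0.
- by apply: le_trans duv; have := expR_ge1Dx (u - v); lra.
- by rewrite ler_expR lerN2.
Qed.

(** On the time scale [E], the geometric law of ratio [lam] has rate [a], which is within [8 * eta]
    of 1. The error splits into rounding and prefactors, proportional to [eta], and the change of
    rate from [a] to 1. *)
Lemma exponential_tail (R : realType) (f : nat -> R) (lam E eta s : R) :
    0 < lam < 1 -> 1 - lam <= 2 * eta -> 0 < eta -> 12 * eta <= 1 -> 0 < E -> 0 < s ->
    (forall t, (1 - 4 * eta) * lam ^+ t <= f t <= (1 + 4 * eta) * lam ^+ t) ->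
    1 - 4 * eta <= E * (1 - lam) <= 1 + 4 * eta ->
  `|f (Num.truncn (s * E)) - expR (- s)| <=
    (10 * eta + Num.sqrt (8 * eta)) *
      expR (- ((1 - (8 * eta + Num.sqrt (8 * eta))) * s)).
Proof.
move=> /andP[lam0 lam1] lam_near eta0 eta12 E0 s0 hf /andP[Elo Ehi].
pose l := - ln lam; pose a := E * l.
have lamE n : lam ^+ n = expR (- (n%:R * l)) by rewrite mulrN opprK expRM_natl lnK.
have l_ge : 1 - lam <= l.
  have := @le_ln1Dx R (- (1 - lam)); rewrite /l (_ : 1 + - (1 - lam) = lam); last by ring.
  by move=> /(_ _) h; have := h ltac:(lra); lra.
have l_le : l <= (1 - lam) / lam.
  have k0 : 0 < (1 - lam) / lam by rewrite divr_gt0// subr_gt0.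
  have := @le_ln1Dx R ((1 - lam) / lam); rewrite (_ : 1 + (1 - lam) / lam = lam^-1); last first.
    by field; rewrite gt_eqF.
  by rewrite lnV ?posrE// => h; apply: h; lra.
have a_lo : 1 - 4 * eta <= a by apply: le_trans Elo _; rewrite ler_wpM2l// ltW.
have a_hi : a <= 1 + 8 * eta.
  apply: (@le_trans _ _ (E * ((1 - lam) / lam))); first by rewrite ler_wpM2l// ltW.
  rewrite mulrA ler_pdivrMr//; apply: le_trans Ehi _.
  by apply: (@le_trans _ _ ((1 + 8 * eta) * (1 - 2 * eta))); [nra | rewrite ler_wpM2l//; lra].
have l0 : 0 <= l by apply: le_trans l_ge; lra.
have /andP[n_le n_gt] := truncn_itv (mulr_ge0 (ltW s0) (ltW E0)).
set n := Num.truncn _ in n_le n_gt *.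
have lam_lo : expR (- (a * s)) <= lam ^+ n.
  by rewrite lamE ler_expR lerN2 /a mulrAC ler_wpM2r// mulrC.
(* As [s * E < n.+1], rounding costs at most one factor [lam], and [1 <= (1 + 4 * eta) * lam]. *)
have lam_hi : lam ^+ n <= (1 + 4 * eta) * expR (- (a * s)).
  have h : lam ^+ n.+1 <= expR (- (a * s)).
    by rewrite lamE ler_expR lerN2 /a mulrAC ler_wpM2r// mulrC ltW.
  have ln0 : 0 <= lam ^+ n by rewrite exprn_ge0// ltW.
  apply: (@le_trans _ _ ((1 + 4 * eta) * lam * lam ^+ n)).
    by rewrite ler_peMl//; nra.
  by rewrite -mulrA -exprS ler_wpM2l//; lra.
have /andP[f_lo f_hi] := hf n.
set e := expR (- (a * s)) in lam_lo lam_hi.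
have e0 : 0 <= e by exact: expR_ge0.
have f_near : `|f n - e| <= 10 * eta * e.
  have h1 : (1 - 4 * eta) * e <= (1 - 4 * eta) * lam ^+ n by rewrite ler_wpM2l//; lra.
  have h2 : (1 + 4 * eta) * lam ^+ n <= (1 + 4 * eta) * ((1 + 4 * eta) * e).
    by rewrite ler_wpM2l//; lra.
  have h3 : (1 + 4 * eta) * ((1 + 4 * eta) * e) <= (1 + 10 * eta) * e.
    by rewrite mulrA ler_wpM2r//; nra.
  by rewrite ler_distl; apply/andP; split; nra.
have m_le : (1 - 8 * eta) * s <= a * s by rewrite ler_wpM2r ?(ltW s0)//; lra.
have e_near : `|e - expR (- s)| <= 8 * eta * s * expR (- ((1 - 8 * eta) * s)).
  apply: expRN_dist_le => //; first by rewrite ler_piMl ?(ltW s0)//; lra.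
  rewrite -{2}[s]mul1r -mulrBl normrM [`|s|]gtr0_norm// ler_wpM2r ?(ltW s0)//.
  by rewrite ler_norml; apply/andP; split; lra.
(* The factor [s] in [e_near] is unbounded; [8 * eta * s = r * (r * s) <= r * expR (r * s)] trades
   it for a loss [r] in the rate. *)
set r := Num.sqrt (8 * eta).
have r0 : 0 < r by rewrite sqrtr_gt0; lra.
have r2 : 8 * eta = r * r by rewrite -expr2 sqr_sqrtr//; lra.
set m := (1 - 8 * eta) * s in m_le e_near.
have splitE : expR (- ((1 - (8 * eta + r)) * s)) = expR (r * s) * expR (- m).
  by rewrite -expRD /m; congr expR; ring.
have rs : r * s <= expR (r * s) by have := expR_ge1Dx (r * s); lra.
have rs1 : 1 <= expR (r * s) by rewrite -[leLHS]expR0 ler_expR mulr_ge0 ?ltW.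
rewrite -(subrK e (f n)) -addrA; apply: le_trans (ler_normD _ _) _.
rewrite splitE mulrDl; apply: lerD.
  apply: le_trans f_near _; rewrite ler_wpM2l//; first by lra.
  apply: (@le_trans _ _ (expR (- m))); first by rewrite ler_expR lerN2.
  by rewrite ler_peMl ?expR_ge0.
apply: le_trans e_near _; rewrite r2 mulrA ler_wpM2r ?expR_ge0//.
by rewrite -mulrA ler_wpM2l ?(ltW r0).
Qed.

(** * The exponential law at fixed temperature and the choice of the time scale *)

Section ExponentialLaw.
Variables (R : realType) (X : finType) (H : X -> R) (q : X -> X -> R).
Hypothesis q_ge0 : forall a b, 0 <= q a b.
Hypothesis q_stoch : forall a, \sum_(b : X) q a b = 1.
Hypothesis q_sym : forall a b, q a b = q b a.
Hypothesis q_irr : forall a b, exists s, path_from_to q a b s.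
Variable A : {set X}.
Hypothesis A_nonempty : A != finset.set0.

Lemma surv_geometric (b : R) : 0 < b -> exists c s : R, [/\ 0 <= c, 0 < s < 1 &
  forall n y, y \notin A -> surv H q b A n y <= c * s ^+ n * s ^+ n].
Proof.
move=> b0; have [C [K [C1 K0 hS]]] := survival_bound H q_ge0 q_stoch q_sym q_irr A_nonempty.
set D := C * expR (b * Gtilde H q (~: A)) in hS.
have D0 : 0 < D by rewrite mulr_gt0 ?expR_gt0//; lra.
(* [survival_bound] gives the exponent [- n./2 / D], where [n./2] is at least [(n - 1) / 2]. The two
   factors [expR (- d) ^+ n] take [- n / (2 * D)], and the extra [2 * d] in the constant pays for
   odd [n]. *)
pose d := D^-1 / 4; have d0 : 0 < d by rewrite divr_gt0// invr_gt0.
exists (expR (K * (1 + b) + 2 * d)), (expR (- d)); split.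
- exact: expR_ge0.
- by rewrite expR_gt0 -[ltRHS]expR0 ltr_expR oppr_lt0.
move=> n y yA; apply: (@le_trans _ _ (surv H q b A (2 * n./2) y)).
  rewrite -{1}(odd_double_half n) addnC -mul2n; case: (odd n); last by rewrite addn0.
  by rewrite addn1 surv_anti.
apply: le_trans (hS _ _ _ b0 yA) _; rewrite -!expRM_natl -!expRD ler_expR -/D.
have -> : (n./2)%:R / D = (n./2)%:R * (4 * d).
  by rewrite /d; field; rewrite gt_eqF.
have : n%:R <= 2 * (n./2)%:R + 1 :> R.
  rewrite -{1}(odd_double_half n) addnC -mul2n natrD natrM lerD2l.
  by case: (odd n).
by nra.
Qed.

Variable x : X.
Hypothesis xA : x \notin A.

Lemma exponential_law_at (b eta : R) (r : nat) : 0 < b -> 0 < eta -> 12 * eta <= 1 ->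
    (0 < r)%N -> r%:R <= eta * Etau H q b A x ->
    (forall y, y \notin A :|: [set x]%SET -> surv H q b (A :|: [set x]%SET) r y <= eta) ->
  forall s : R, 0 < s ->
  `|tail H q b A x (s * Etau H q b A x) - expR (- s)| <=
    (10 * eta + Num.sqrt (8 * eta)) *
      expR (- ((1 - (8 * eta + Num.sqrt (8 * eta))) * s)).
Proof.
move=> b0 eta0 eta12 r0 r_le quick s s_gt0; set E := Etau H q b A x.
have [c [rho [c0 rho01 hS]]] := surv_geometric b0.
have /andP[rho0 rho1] := rho01.
have S0 := surv_ge0 H q_ge0 q_stoch b0.
have [sum_le sum_sup] := @mean_is_tail_sum R (fun n => surv H q b A n x) c rho
  (fun n => introT andP (conj (S0 A n x) (hS n x xA))) rho01 c0.
have E1 : 1 <= E by have := sum_le 1; rewrite big_nat1.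
have max0 : max_surv H q b A 0 = 1.
  apply/eqP; rewrite eq_le max_surv_le//=; exact: (surv_le_max H q b 0 xA).
have maxS n : surv H q b A n x <= max_surv H q b A n by exact: surv_le_max.
have max1 n : max_surv H q b A n <= 1.
  by apply: max_surv_le => // y _; exact: surv_le1.
have absorb u : max_surv H q b A (r + u) <= eta * max_surv H q b A u + surv H q b A u x.
  apply: max_surv_le => [|y yA].
    by rewrite addr_ge0 ?S0// mulr_ge0 ?max_surv_ge0// ltW.
  (* [quick] excludes the start [x], where monotonicity in time suffices. *)
  have [->|yx] := eqVneq y x.
    apply: (@le_trans _ _ (surv H q b A u x)); last first.
      by rewrite lerDr mulr_ge0 ?max_surv_ge0// ltW.
    by elim: (r) => [//|n hn]; rewrite addSn (le_trans (surv_anti H q_ge0 q_stoch b0 _ _ _)).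
  apply: le_trans (surv_le_absorb H q_ge0 q_stoch b0 xA r u yA) _.
  by rewrite lerD2r ler_wpM2r ?max_surv_ge0// quick// !inE negb_or yA.
have lt1 : exists N, max_surv H q b A N < 1.
  have cv : geometric c rho n @[n --> \oo] --> (0 : R).
    by apply: cvg_geometric; rewrite ger0_norm// ltW.
  have [N _ /(_ N (leqnn N)) hN] := cvgr_lt _ cv _ (@ltr01 R).
  exists N; apply: le_lt_trans hN; apply: max_surv_le => [|y yA].
    by rewrite mulr_ge0// exprn_ge0// ltW.
  apply: le_trans (hS N y yA) _; rewrite ler_piMr ?mulr_ge0 ?exprn_ge0 ?(ltW rho0)//.
  by apply: exprn_ile1; exact: ltW.
have [lam [lam01 lam_near hlam hE]] := @near_geometric_survival R (fun n => surv H q b A n x)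
  (max_surv H q b A) r E eta (fun n => S0 A n x) maxS max1 max0 erefl
  (max_surv_sub H q_ge0 q_stoch b0 A) absorb
  (fun t u => surv_supermultiplicative q_ge0 q_stoch b0 xA (ltW eta0) quick t u xA)
  lt1 sum_le sum_sup eta0 eta12 r0 r_le.
exact: (@exponential_tail R (fun n => surv H q b A n x) lam E eta s lam01 lam_near eta0 eta12
  (lt_le_trans ltr01 E1) s_gt0 hlam hE).
Qed.

Lemma quick_absorption (Theta : R) :
    ln (Etau H q b A x) / b @[b --> +oo] --> Theta ->
    Gtilde H q (~: (A :|: [set x]%SET)) < Theta ->
  exists eta : R -> R, [/\ forall b, 0 < eta b, eta b @[b --> +oo] --> (0 : R) &
    \forall b \near +oo, exists r, [/\ (0 < r)%N, r%:R <= eta b * Etau H q b A x &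
      forall y, y \notin A :|: [set x]%SET ->
        surv H q b (A :|: [set x]%SET) r y <= eta b]].
Proof.
move=> cvTheta; set A' := A :|: [set x]%SET; set G := Gtilde H q (~: A') => G_lt.
have G0 : 0 <= G by exact: bigmax_ge_id.
have A'0 : A' != finset.set0 by apply/set0Pn; exists x; rewrite !inE eqxx orbT.
have [C [K [C1 K0 hS]]] := survival_bound H q_ge0 q_stoch q_sym q_irr A'0.
(* A third of the gap: the mean eventually exceeds [expR ((G + 2 * eps) * b)], while [r] stays below
   the order of [expR ((G + eps) * b)]. *)
pose eps := (Theta - G) / 3; have eps0 : 0 < eps by rewrite /eps; lra.
pose M := 2 * ((C * (K + 1) + 1) * (1 + eps^-1)).
have ie0 : 0 < eps^-1 by rewrite invr_gt0.
have M0 : 0 < M by rewrite /M !mulr_gt0//; nra.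
(* The first term bounds the survival up to time [r], the second the ratio of [r] to the mean. *)
exists (fun b => expR (- b) + M * expR (- (eps * b))); split.
- by move=> b; apply: addr_gt0; [exact: expR_gt0 | exact: mulr_gt0 M0 (expR_gt0 _)].
- have eb : eps * b @[b --> +oo] --> +oo by apply: gt0_cvgMry => //; exact: cvg_id.
  have h1 := @cvgr_expR R.
  have h2 : expR (- (eps * b)) @[b --> +oo] --> (0 : R) := cvg_comp _ _ eb h1.
  have h3 := cvgMl_tmp (a := M) h2; rewrite mulr0 in h3.
  by have h4 := cvgD h1 (h3 _); rewrite addr0 in h4; exact: h4.
have G2 : G + 2 * eps < Theta by rewrite /eps; lra.
have near_ln := cvgr_gt _ cvTheta _ G2.
have near_pos := @nbhs_pinfty_gt R 0 (real0 _).
near=> b.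
have b0 : 0 < b by near: b.
have lnb : G + 2 * eps < ln (Etau H q b A x) / b by near: b; exact: near_ln.
have {lnb} : (G + 2 * eps) * b < ln (Etau H q b A x).
  by rewrite -ltr_pdivlMr.
(* [ln] vanishes at nonpositive arguments, so the strict bound [lnE], whose left side is
   nonnegative, forces a positive mean. *)
move=> lnE; have Epos : 0 < Etau H q b A x.
  rewrite ltNge; apply/negP => E0; move: lnE; rewrite ln0// ltNge mulr_ge0 ?(ltW b0)//.
  by rewrite addr_ge0// mulr_ge0// ltW.
have Ege : expR ((G + 2 * eps) * b) <= Etau H q b A x.
  by rewrite -[leRHS]lnK ?posrE// ler_expR ltW.
pose D := C * expR (b * G).
have D0 : 0 < D by rewrite mulr_gt0 ?expR_gt0//; lra.
(* Any [t] above [u] makes the exponent [K * (1 + b) - t%:R / D] of [survival_bound] at most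
   [- b]. *)
pose u := D * (K * (1 + b) + b).
have u0 : 0 <= u by rewrite mulr_ge0 ?(ltW D0)//; nra.
have /andP[u_ge u_lt] := truncn_itv u0.
set t := (Num.truncn u).+1 in u_lt.
have t_le : t%:R <= u + 1 by rewrite /t -natr1 lerD2r.
exists (2 * t)%N; split => //.
- have E1 : expR (b * G) * expR (eps * b) = expR (- (eps * b)) * expR ((G + 2 * eps) * b).
    by rewrite -!expRD; congr expR; ring.
  have eb1 : 1 <= expR (eps * b) by rewrite -[leLHS]expR0 ler_expR mulr_ge0 ?ltW.
  have G1 : 1 <= expR (b * G) by rewrite -[leLHS]expR0 ler_expR mulr_ge0// ltW.
  (* One spare factor [expR (eps * b)] absorbs the linear growth of [1 + b]; the other one makes the
     ratio of [r] to the mean vanish. *)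
  have eb2 : 1 + b <= (1 + eps^-1) * expR (eps * b).
    rewrite mulrDl mul1r lerD// ler_pdivlMl//.
    by have := expR_ge1Dx (eps * b); lra.
  apply: (@le_trans _ _ (M * expR (- (eps * b)) * Etau H q b A x)); last first.
    by rewrite ler_wpM2r ?(ltW Epos)// lerDr expR_ge0.
  apply: (@le_trans _ _ (M * (expR (b * G) * expR (eps * b)))); last first.
    by rewrite E1 mulrA; apply: ler_wpM2l Ege; exact: mulr_ge0 (ltW M0) (expR_ge0 _).
  have -> : M * (expR (b * G) * expR (eps * b)) =
      2 * (expR (b * G) * (C * (K + 1) + 1) * ((1 + eps^-1) * expR (eps * b))).
    by rewrite /M; ring.
  rewrite natrM ler_wpM2l//; apply: le_trans t_le _.
  apply: (@le_trans _ _ (expR (b * G) * (C * (K + 1) + 1) * (1 + b))); last first.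
    by rewrite ler_wpM2l// mulr_ge0 ?expR_ge0//; nra.
  rewrite /u /D.
  have -> : C * expR (b * G) * (K * (1 + b) + b) = expR (b * G) * (C * (K * (1 + b) + b)) by ring.
  have h : C * (K * (1 + b) + b) <= C * (K + 1) * (1 + b).
    by rewrite -mulrA ler_wpM2l//; [lra | nra].
  have h' := ler_wpM2l (expR_ge0 (b * G)) h.
  have h1 : 1 <= expR (b * G) * (1 + b) by nra.
  by lra.
- move=> y yA'; apply: le_trans (hS _ _ _ b0 yA') _.
  rewrite -[leLHS]addr0; apply: lerD; last exact: mulr_ge0 (ltW M0) (expR_ge0 _).
  rewrite ler_expR -/G -/D.
  have : K * (1 + b) + b <= t%:R / D by rewrite ler_pdivlMr// mulrC ltW.
  by lra.
Unshelve. all: by end_near.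
Qed.

End ExponentialLaw.

Theorem theorem3p19 (R : realType) (X : finType) (H : X -> R) (q : X -> X -> R)
  (Hnonconst : exists a b : X, H a != H b)
  (q_ge0 : forall a b, 0 <= q a b)
  (q_stoch : forall a, \sum_(b : X) q a b = 1)
  (q_sym : forall a b, q a b = q b a)
  (q_irr : forall a b, exists s, path_from_to q a b s)
  (A : {set X}) (x : X)
  (A_nonempty : A != finset.set0) (x_notin_A : x \notin A)
  (A_conv : forall y, (forall s, path_from_to q x y s -> has (fun z => z \in A) (x :: s)) ->
            y \in A)
  (assumptionB : exists Theta : R,
      (fun b : R => ln (Etau H q b A x) / b) @ +oo --> Theta /\
      Gtilde H q (~: (A :|: [set x])) < Theta) :
  exists k1 k2 : R -> R,
    [/\ k1 @ +oo --> (0 : R), k2 @ +oo --> (0 : R) &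
        forall b s : R, 0 < b -> 0 < s ->
          `| tail H q b A x (s * Etau H q b A x) - expR (- s) |
            <= k1 b * expR (- ((1 - k2 b) * s))].
Proof.
have [Th [cvTh G_lt]] := assumptionB.
have [eta [eta0 eta_cvg quick]] :=
  quick_absorption q_ge0 q_stoch q_sym q_irr cvTh G_lt.
(* [good b] gathers what [exponential_law_at] requires. It is known only for large [b], whereas the
   bound must hold for every [b > 0]. *)
pose good b := 12 * eta b <= 1 /\ exists r, [/\ (0 < r)%N, r%:R <= eta b * Etau H q b A x &
  forall y, y \notin A :|: [set x]%SET -> surv H q b (A :|: [set x]%SET) r y <= eta b].
have good_near : \forall b \near +oo, good b.
  have eta_small : \forall b \near +oo, eta b < 12^-1 by apply: cvgr_lt eta_cvg _ _.
  near=> b; split; last by near: b.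
  have : eta b < 12^-1 by near: b.
  by lra.
(* The bound is trivial with k1 = k2 = 1, which covers the temperatures that are not [good]. *)
pose k (f : R -> R) b := if `[< good b >] then f (eta b) else 1.
have k_cvg (f : R -> R) : f e @[e --> 0] --> (0 : R) -> k f b @[b --> +oo] --> (0 : R).
  move=> f0; apply: cvg_trans (cvg_comp _ _ eta_cvg f0); apply: near_eq_cvg.
  near=> b; rewrite /k /=; have gb : good b by near: b.
  by rewrite asboolT.
have sqrt0 : Num.sqrt (8 * e) @[e --> (0 : R)] --> (0 : R).
  have h : 8 * e @[e --> (0 : R)] --> 8 * (0 : R) by apply: cvgMl_tmp.
  have h' : Num.sqrt e @[e --> (0 : R)] --> Num.sqrt (0 : R) := @sqrt_continuous R 0.
  by rewrite mulr0 in h; rewrite sqrtr0 in h'; exact: (cvg_comp _ _ h h').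
have lin0 (c : R) : c * e + Num.sqrt (8 * e) @[e --> (0 : R)] --> (0 : R).
  have h : c * e @[e --> (0 : R)] --> c * (0 : R) by apply: cvgMl_tmp.
  by rewrite mulr0 in h; have h' := cvgD h sqrt0; rewrite addr0 in h'; exact: h'.
exists (k (fun e => 10 * e + Num.sqrt (8 * e))), (k (fun e => 8 * e + Num.sqrt (8 * e))).
split; [exact: k_cvg | exact: k_cvg |] => b s b0 s0.
rewrite /k; case: asboolP => [[eta12 [r [r0 r_le r_quick]]]|_].
  exact: (exponential_law_at q_ge0 q_stoch q_sym q_irr A_nonempty x_notin_A b0 (eta0 b)
    eta12 r0 r_le r_quick s0).
rewrite subrr mul0r oppr0 expR0 mulr1 ler_norml.
have e0 := expR_ge0 (- s); have e1 : expR (- s) <= 1.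
  by rewrite -[leRHS]expR0 ler_expR oppr_le0 ltW.
have t0 := surv_ge0 H q_ge0 q_stoch b0 A (Num.truncn (s * Etau H q b A x)) x.
have t1 := surv_le1 H q_ge0 q_stoch b0 A (Num.truncn (s * Etau H q b A x)) x.
by apply/andP; split; rewrite /tail; lra.
Unshelve. all: by end_near.
Qed.
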